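(* Let $A\in\mathbb{R}^{n\times n}$ be a nonsingular matrix. The following two conditions are equivalent: (1) For any vector $x\in\mathbb{R}^n\setminus\{0\}$, $$s_c^+(Ax)\le s_c^-(x).$$ (2) The matrix $A$ is $SSR_r$ for all odd $r$ in the range $r\in\{1,\dots,n\}$.
   Context: Sign variations. For a vector $y\in\mathbb{R}^m$ with no zero entries, $\sigma(y)$ is the number of indices $k\in\{1,\dots,m-1\}$ with $y_ky_{k+1}<0$. For any $y\in\mathbb{R}^m$: $s^-(y):=\sigma(\bar y)$, where $\bar y$ is obtained from $y$ by deleting all zero entries (and $s^-(0):=0$); $s^+(y):=\max_{z\in P(y)}\sigma(z)$, where $P(y)$ is the set of vectors obtained from $y$ by replacing each zero entry by either $1$ or $-1$. Cyclic sign variations. For $y\in\mathbb{R}^n$, $$s_c^-(y):=\max_{i\in\{1,\dots,n\}} s^-\big([y_i,\dots,y_n,y_1,\dots,y_i]'\big),\qquad s_c^+(y):=\max_{i\in\{1,\dots,n\}} s^+\big([y_i,\dots,y_n,y_1,\dots,y_i]'\big),$$ where each bracketed vector has $n+1$ entries (it goes once around the ring, beginning and ending with $y_i$), and where in the definition of $s_c^+$, if $y_i=0$, then both copies of $y_i$ (the first and the last entry) are replaced by the same value, either $1$ or $-1$. Sign regularity. A matrix is $SSR_r$ (strictly sign-regular of order $r$) if all its minors of order $r$ are non-zero and have the same sign. *)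

(* Defs.v *)
From mathcomp Require Import all_boot all_order all_algebra.
From mathcomp Require Import reals.

Set Implicit Arguments.
Unset Strict Implicit.
Unset Printing Implicit Defensive.

Import Order.TTheory GRing.Theory Num.Theory.
Local Open Scope ring_scope.

(* Vectors whose length varies (zeros deleted, first entry repeated at the    *)
(* end) are represented as sequences, indexed from 0.                         *)

(* Meant for sequences without zero entries. *)
Definition sigma (R : realDomainType) (y : seq R) : nat :=
  #|[set k : 'I_(size y).-1 | y`_k * y`_k.+1 < 0]|.

Definition s_minus (R : realDomainType) (y : seq R) : nat :=
  sigma [seq a <- y | a != 0].

(* As e ranges over all boolean tuples, fill_zeros e ranges over P(y). *)
Definition fill_zeros (R : realDomainType) (y : seq R)
    (e : (size y).-tuple bool) : seq R :=
  mkseq (fun k => if y`_k == 0 then (-1) ^+ nth false e k else y`_k) (size y).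

(* The default value 0 of \max is never used here, since at least one e      *)
(* always exists; the same holds in s_plus_around.                            *)
Definition s_plus (R : realDomainType) (y : seq R) : nat :=
  \max_(e : (size y).-tuple bool) sigma (fill_zeros e).

(* [y_i, ..., y_(n-1), y_0, ..., y_i] *)
Definition around (R : realDomainType) (y : seq R) (i : nat) : seq R :=
  rcons (rot i y) y`_i.

Definition s_c_minus (R : realDomainType) (y : seq R) : nat :=
  \max_(i < size y) s_minus (around y i).

(* Both copies of y_i are replaced by the same value when y_i = 0; the        *)
(* condition on e is automatic when y_i <> 0 (lemma s_plus_aroundE below).    *)
Definition s_plus_around (R : realDomainType) (y : seq R) (i : nat) : nat :=
  \max_(e : (size (around y i)).-tuple bool
          | head 0%R (fill_zeros e) == last 0%R (fill_zeros e))
    sigma (fill_zeros e).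

Definition s_c_plus (R : realDomainType) (y : seq R) : nat :=
  \max_(i < size y) s_plus_around y i.

Lemma s_plus_aroundE (R : realDomainType) (y : seq R) (i : nat) :
  (i < size y)%N -> y`_i != 0 -> s_plus_around y i = s_plus (around y i).
Proof.
move=> lt_iy yi_neq0; rewrite /s_plus_around /s_plus; apply: eq_bigl => e.
have sz : size (around y i) = (size y).+1 by rewrite size_rcons size_rot.
have szf : size (fill_zeros e) = (size y).+1 by rewrite size_mkseq sz.
rewrite -nth0 -nth_last szf /= !nth_mkseq ?sz //.
have -> : (around y i)`_(size y) = y`_i.
  by rewrite nth_rcons size_rot ltnn eqxx.
have -> : (around y i)`_0 = y`_i.
  by rewrite nth_rcons size_rot (leq_ltn_trans (leq0n i)) // nth_cat size_drop
             subn_gt0 lt_iy nth_drop addn0.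
by rewrite (negPf yi_neq0) eqxx.
Qed.

Definition entries (R : realDomainType) (n : nat) (y : 'cV[R]_n) : seq R :=
  [seq y i ord0 | i <- enum 'I_n].

(* An order-r minor is indexed by strictly increasing row and column          *)
(* selections, i.e. by r-element sets of rows and of columns.                 *)
Definition increasing_sel (r m : nat) (f : 'I_r -> 'I_m) : Prop :=
  {homo f : i j / (i < j)%N}.

Definition SSR (R : realDomainType) (m n r : nat) (A : 'M[R]_(m, n)) : Prop :=
  (forall (f : 'I_r -> 'I_m) (g : 'I_r -> 'I_n),
     increasing_sel f -> increasing_sel g -> \det (mxsub f g A) != 0) /\
  (forall (f f' : 'I_r -> 'I_m) (g g' : 'I_r -> 'I_n),
     increasing_sel f -> increasing_sel f' ->
     increasing_sel g -> increasing_sel g' ->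
     Num.sg (\det (mxsub f g A)) = Num.sg (\det (mxsub f' g' A))).

Arguments SSR {R m n} r A.

(* Main.v *)
Require Import Defs.
From mathcomp Require Import all_boot all_order all_algebra.
From mathcomp Require Import reals.
From mathcomp Require Import zify ring.

(* A cyclic variation count is the corresponding linear one rounded up to the *)
(* next even number. Condition (1) therefore says that for every odd r <= n,  *)
(* s^-(x) < r implies s^+(Ax) < r; for each single r this linear property is  *)
(* equivalent to SSR_r.                                                       *)
(* If A is SSR_r and s^-(x) < r, cut the indices into r consecutive blocks on *)
(* which x has weakly constant sign and factor x = W c with W >= 0 supported  *)
(* on the blocks: all order-r minors of A W have one strict sign. If y = A x  *)
(* had s^+(y) >= r, then y would alternate weakly along r+1 rows, and         *)
(* expanding the determinant of [y, A W] on these rows would force y = 0      *)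
(* there, hence c = 0.                                                        *)
(* Conversely, for r < n, a vanishing minor yields x with at most r nonzero   *)
(* entries such that A x has r zeros. Minors whose rows (columns) lie in a    *)
(* common (r+1)-set are compared by solving A x = y on these rows with y      *)
(* alternating (by the vector of signed minors, whose image has r zeros).     *)

Import Order.TTheory GRing.Theory Num.Theory.
Local Open Scope ring_scope.

Set Implicit Arguments.
Unset Strict Implicit.
Unset Printing Implicit Defensive.

(** Closing a sequence into a ring adds one sign change exactly when the linear count is odd. Hence
    comparing a cyclic count with an even bound is the same as comparing the linear one
    ([s_c_minus_leq], [s_c_plus_leq]), and only bounds of the form [r.-1] with [r] odd occur. This
    is why only odd orders appear in condition (2). For one fixed [r], the implication from
    [s_minus x < r] to [s_plus (A x) < r] follows from [SSR r A] by [SSR_s_plus_lt], which combines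
    [block_factorization] with [s_plus_mulmx_lt]. The converse is [vd_SSR]: minors of order [r < n]
    are nonzero by [vd_minor_neq0], their signs agree inside each set of [r + 1] rows or columns by
    [vd_sg_row] and [vd_sg_col], and [increasing_sel_chain] links all selections through such
    sets. *)

Section Selections.

(** * Increasing selections of indices *)

Lemma increasing_sel_inj r m (f : 'I_r -> 'I_m) : increasing_sel f -> injective f.
Proof.
move=> f_inc l l' /(congr1 val) /= eq_f; apply/val_inj.
by case: (ltngtP l l') => // /f_inc; rewrite eq_f ltnn.
Qed.

Lemma increasing_sel_lift r m (h : 'I_r.+1 -> 'I_m) l :
  increasing_sel h -> increasing_sel (h \o lift l).
Proof.
move=> h_inc i j lt_ij; apply: h_inc.
by rewrite /= ltnNge leq_bump2 -ltnNge.
Qed.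

Lemma increasing_sel_set m (S : {set 'I_m}) r : #|S| = r ->
  exists2 h : 'I_r -> 'I_m, increasing_sel h & forall l, h l \in S.
Proof.
move=> <-; exists enum_val; last exact: enum_valP.
move=> i j lt_ij; have x0 := enum_val i; rewrite !(enum_val_nth x0).
have tr : transitive (relpre (@nat_of_ord m) ltn) by move=> ? ? ?; apply: ltn_trans.
have srt : sorted (relpre (@nat_of_ord m) ltn) (enum S).
  rewrite {1}/enum_mem -enumT; apply: (sorted_filter tr).
  by have := iota_ltn_sorted 0 m; rewrite -val_enum_ord sorted_map.
by apply: (sorted_ltn_nth tr x0 srt) lt_ij; rewrite inE -cardE ltn_ord.
Qed.

Variables (m : nat) (T : Type).

(* Every selection can be brought to 0, ..., r-1 by repeatedly decreasing its *)
(* first index that is not yet in place.                                      *)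
Lemma increasing_sel_chain r (phi : ('I_r -> 'I_m) -> T) :
  (forall f g, f =1 g -> phi f = phi g) ->
  (forall (h : 'I_r.+1 -> 'I_m) i j, increasing_sel h ->
     phi (h \o lift i) = phi (h \o lift j)) ->
  forall f g, increasing_sel f -> increasing_sel g -> phi f = phi g.
Proof.
move=> phi_ext phi_step.
have geq_sel (f : 'I_r -> 'I_m) : increasing_sel f -> forall i : 'I_r, (i <= f i)%N.
  move=> f_inc [i lt_i]; elim: i lt_i => // i IHi lt_i.
  by apply: leq_ltn_trans (IHi (ltnW lt_i)) _; apply: f_inc => /=.
suff norm f : increasing_sel f ->
    exists2 f0 : 'I_r -> 'I_m, forall i, f0 i = i :> nat & phi f = phi f0.
  move=> f g /norm[f0 f0E ->] /norm[g0 g0E ->]; apply: phi_ext => i.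
  by apply/val_inj; rewrite /= f0E g0E.
have [k] := ubnP (\sum_i f i)%N; elim: k f => // k IHk f /ltnSE le_k f_inc.
case: (pickP (fun i => f i != i :> nat)) => [i0 i0P | f_id]; last first.
  by exists f => // i; apply/eqP/negbNE; rewrite f_id.
have [i /= fi_neq i_min] :=
  @arg_minnP _ i0 (fun i => f i != i :> nat) (@nat_of_ord r) i0P.
have lt_if : (i < f i)%N by rewrite ltn_neqAle eq_sym fi_neq geq_sel.
have f_small (j : 'I_r) : (j < i)%N -> f j = j :> nat.
  by move=> lt_ji; apply/eqP; apply: contraLR lt_ji; rewrite -leqNgt => /i_min.
have lt_pred : ((f i).-1 < m)%N by rewrite (leq_ltn_trans (leq_pred _)).
(* [h] inserts the value [(f i).-1] just before [f i], at positions [p] and [q = p + 1]. Omitting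
   [p] gives [f] back; omitting [q] gives [f] with its value at [i] lowered by one, so the sum of
   the values drops. *)
pose p := widen_ord (leqnSn r) i; pose q := lift ord0 i.
pose h j := if unlift p j is Some l then f l else Ordinal lt_pred.
have h_p l : h (lift p l) = f l by rewrite /h liftK.
have h_inc : increasing_sel h.
  move=> a b; rewrite /h; case: unliftP => [l|] ->; case: unliftP => [l'|] ->;
  rewrite ?ltnn //= /bump => lt_ab.
  - by apply: f_inc; rewrite ltnNge -(leq_bump2 i) -ltnNge.
  - have lt_li : (l < i)%N by move: lt_ab; case: (leqP i l) => /=; lia.
    by rewrite f_small //; lia.
  - have: (i <= l')%N by move: lt_ab; case: (leqP i l') => /=; lia.
    by rewrite leq_eqVlt => /predU1P[/val_inj <- | /f_inc]; lia.
have -> : phi f = phi (h \o lift q).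
  by rewrite -(phi_step h p q h_inc); apply: phi_ext => l; rewrite /= h_p.
apply: IHk; last exact: increasing_sel_lift.
apply: leq_trans le_k; rewrite (bigD1 i) //= [X in (_ < X)%N](bigD1 i) //= -addSn.
have lift_qi : lift q i = p by apply: val_inj; rewrite /= /bump /= add1n ltnn.
apply: leq_add.
  by rewrite lift_qi /h unlift_none /=; lia.
apply: leq_sum => l l_neq; suff -> : lift q l = lift p l by rewrite h_p.
apply: val_inj => /=; rewrite /bump /= add1n.
by have : l != i :> nat := l_neq; case: leqP; case: leqP => /=; lia.
Qed.

End Selections.

(** * Linear and cyclic sign variations *)

Section SignVariations.
Variable R : realDomainType.
Implicit Types (a b : R) (s t y : seq R).

Lemma sigma_sum s :
  sigma s = (\sum_(k < (size s).-1) (s`_k * s`_k.+1 < 0)%R)%N.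
Proof. by rewrite /sigma -sum1dep_card big_mkcond. Qed.

Lemma sigma_cons a b s : sigma [:: a, b & s] = ((a * b < 0)%R + sigma (b :: s))%N.
Proof. by rewrite !sigma_sum /= big_ord_recl. Qed.

Lemma sigma_nil : sigma ([::] : seq R) = 0%N.
Proof. by rewrite sigma_sum big_ord0. Qed.

Lemma sigma1 a : sigma [:: a] = 0%N.
Proof. by rewrite sigma_sum big_ord0. Qed.

Lemma sigma_size s : (sigma s <= (size s).-1)%N.
Proof. by rewrite /sigma (leq_trans (max_card _)) ?card_ord. Qed.

Lemma sigma_cat s a t :
  sigma (s ++ a :: t) = (sigma (rcons s a) + sigma (a :: t))%N.
Proof.
elim: s => [|b [|c s] IHs] /=; first by rewrite sigma1.
  by rewrite !sigma_cons sigma1 addn0.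
by rewrite !sigma_cons -addnA -IHs.
Qed.

(** Each change flips the sign, so the parity of their number compares the two end entries. *)
Lemma odd_sigma a s : a != 0 -> all (fun b => b != 0) s ->
  odd (sigma (a :: s)) = (a * last a s < 0).
Proof.
elim: s a => [|b s IHs] a a0 /=; first by rewrite sigma1 -expr2 ltNge sqr_ge0.
case/andP=> b0 s0; rewrite sigma_cons oddD oddb IHs //.
have l0 : last b s != 0.
  by apply: (allP (_ : all (fun c => c != 0) (b :: s))); rewrite /= ?b0 // mem_last.
move: (last b s) l0 => c l0.
by rewrite !mulr_lt0 a0 b0 l0 /=; case: (a < 0); case: (b < 0); case: (c < 0).
Qed.

(* Meant, like sigma, for sequences without zero entries. *)
Definition cyclic_sigma s := sigma (rcons s (head 0 s)).

Lemma cyclic_sigma_cat s t : cyclic_sigma (s ++ t) = cyclic_sigma (t ++ s).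
Proof.
case: s t => [|a s] [|b t]; rewrite ?cats0 //= /cyclic_sigma /= !rcons_cat /=.
rewrite -!cat_cons !sigma_cat; exact: addnC.
Qed.

Lemma cyclic_sigma_rot i s : cyclic_sigma (rot i s) = cyclic_sigma s.
Proof. by rewrite -{2}(cat_take_drop i s) cyclic_sigma_cat. Qed.

(** The closing step from the last entry back to the first is a change exactly when the end entries
    differ in sign, which by [odd_sigma] means an odd linear count. *)
Lemma cyclic_sigmaE s : all (fun a => a != 0) s ->
  cyclic_sigma s = (sigma s + odd (sigma s))%N.
Proof.
case: s => [|a s] /=; first by rewrite /cyclic_sigma sigma1 sigma_nil.
case/andP=> a0 s0; rewrite (odd_sigma a0 s0) /cyclic_sigma /=.
case/lastP: s s0 => [|s b] _ /=; first by rewrite sigma_cons !sigma1 addn0.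
have -> : a :: rcons (rcons s b) a = (a :: s) ++ [:: b; a] by rewrite -!cats1 -catA.
by rewrite last_rcons sigma_cat sigma_cons sigma1 addn0 mulrC.
Qed.

Lemma cyclic_sigma_leq s m : all (fun a => a != 0) s -> ~~ odd m ->
  (cyclic_sigma s <= m)%N = (sigma s <= m)%N.
Proof.
move=> s0 oddm; rewrite cyclic_sigmaE //; case: (boolP (odd (sigma s))) => os.
  rewrite addn1 ltn_neqAle andb_idl // => _.
  by apply: contraNneq oddm => <-.
by rewrite addn0.
Qed.

Lemma rot_take_drop y i : (i < size y)%N ->
  y = take i y ++ y`_i :: drop i.+1 y /\
  rot i y = y`_i :: drop i.+1 y ++ take i y.
Proof.
move=> lt_iy; rewrite -(drop_nth 0 lt_iy) cat_take_drop; split => //.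
by rewrite -cat_cons -(drop_nth 0 lt_iy).
Qed.

(** When [y_i] is nonzero, deleting zeros leaves a closed turn around the ring of nonzero entries.
    When [y_i = 0] both of its copies disappear, the turn is no longer closed, and only the
    inequality remains. *)
Lemma s_minus_around y i : (i < size y)%N ->
  (s_minus (around y i) <= cyclic_sigma [seq a <- y | a != 0%R])%N /\
  (y`_i != 0 -> s_minus (around y i) = cyclic_sigma [seq a <- y | a != 0]).
Proof.
move=> lt_iy; have [ey er] := rot_take_drop lt_iy.
have -> : cyclic_sigma [seq a <- y | a != 0] = cyclic_sigma [seq a <- rot i y | a != 0].
  by rewrite [in LHS]ey er -cat_cons !filter_cat cyclic_sigma_cat.
rewrite /s_minus /around er filter_rcons /=; case: (y`_i != 0); split => //.
case/lastP: [seq _ <- _ | _] => [|s a]; first by rewrite sigma_nil.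
by rewrite /cyclic_sigma -(cats1 (rcons s a)) cat_rcons sigma_cat leq_addr.
Qed.

Lemma filter_neq0 y : all (fun a => a != 0) [seq a <- y | a != 0].
Proof. exact: filter_all. Qed.

Lemma s_c_minusE y : s_c_minus y = cyclic_sigma [seq a <- y | a != 0].
Proof.
apply/eqP; rewrite eqn_leq; apply/andP; split.
  by apply/bigmax_leqP => i _; have [] := s_minus_around (ltn_ord i).
case: (boolP (has (fun a => a != 0) y)) => [hy | /hasPn y0]; last first.
  rewrite (_ : [seq _ <- _ | _] = [::]) ?/cyclic_sigma ?sigma1 //.
  by apply/eqP; rewrite -size_eq0 size_filter -leqn0 leqNgt -has_count; apply/hasPn.
have yi0 := nth_find 0 hy.
have lt_iy : (find (fun a => a != 0%R) y < size y)%N by rewrite -has_find.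
rewrite -(proj2 (s_minus_around lt_iy) yi0).
exact: (@leq_bigmax _ (fun i : 'I_(size y) => s_minus (around y i)) (Ordinal lt_iy)).
Qed.

Lemma s_c_minus_even y : ~~ odd (s_c_minus y).
Proof.
by rewrite s_c_minusE cyclic_sigmaE ?filter_neq0 // oddD oddb addbb.
Qed.

Lemma s_c_minus_leq y m : ~~ odd m ->
  (s_c_minus y <= m)%N = (s_minus y <= m)%N.
Proof. by move=> om; rewrite s_c_minusE cyclic_sigma_leq ?filter_neq0. Qed.

(** [fill_zeros] with the bits as a plain sequence, so that it commutes with concatenation, rotation
    and [rcons] without casts on tuple lengths. *)
Definition fill y (e : seq bool) : seq R :=
  [seq if p.1 == 0 then (-1) ^+ p.2 else p.1 | p : R * bool <- zip y e].

Lemma fill_zerosE y (e : (size y).-tuple bool) : fill_zeros e = fill y e.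
Proof.
apply: (@eq_from_nth _ 0) => [|i].
  by rewrite size_mkseq size_map size_zip size_tuple minnn.
rewrite size_mkseq => lt_iy; rewrite nth_mkseq //.
by rewrite (nth_map (0, false)) ?size_zip ?size_tuple ?minnn // nth_zip ?size_tuple.
Qed.

Lemma fill_neq0 y e : all (fun a => a != 0) (fill y e).
Proof.
apply/allP=> _ /mapP[[a b] _ ->] /=; case: ifP => [_ | ->] //.
by rewrite signr_eq0.
Qed.

Lemma size_fill y e : size y = size e -> size (fill y e) = size y.
Proof. by move=> eq_sz; rewrite size_map size_zip eq_sz minnn. Qed.

Lemma fill_cat y1 y2 e1 e2 : size y1 = size e1 ->
  fill (y1 ++ y2) (e1 ++ e2) = fill y1 e1 ++ fill y2 e2.
Proof. by move=> eq_sz; rewrite /fill zip_cat // map_cat. Qed.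

Lemma fill_rot y e i : size y = size e -> (i <= size y)%N ->
  fill (rot i y) (rot i e) = rot i (fill y e).
Proof.
move=> eq_sz le_iy.
have sz_t : size (take i y) = size (take i e) by rewrite !size_takel // -eq_sz.
rewrite -{2}(cat_take_drop i y) -{2}(cat_take_drop i e) fill_cat //.
have szA : size (fill (take i y) (take i e)) = i by rewrite size_fill // size_takel.
rewrite -[X in rot X (_ ++ _)]szA rot_size_cat fill_cat //.
by rewrite !size_drop eq_sz.
Qed.

Lemma fill_rcons y (e : seq bool) a (b : bool) : size y = size e ->
  fill (rcons y a) (rcons e b) = rcons (fill y e) (if a == 0 then (-1) ^+ b else a).
Proof. by move=> eq_sz; rewrite /fill zip_rcons // map_rcons. Qed.

Lemma s_plus_leP y m :
  reflect (forall e, size e = size y -> sigma (fill y e) <= m)%N (s_plus y <= m)%N.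
Proof.
apply: (iffP (bigmax_leqP _ _ _)) => [le_m e /eqP sz_e | le_m e _].
  by have := le_m (Tuple sz_e) isT; rewrite fill_zerosE.
by rewrite fill_zerosE le_m ?size_tuple.
Qed.

Lemma aroundE y i : (i < size y)%N -> around y i = rcons (rot i y) (head 0 (rot i y)).
Proof. by move=> lt_iy; rewrite /around; have [_ ->] := rot_take_drop lt_iy. Qed.

(** Since both copies of the starting entry receive the same value, an admissible filling of a turn
    is a closed rotation of a filling of [y]. Its count is the cyclic one, which [cyclic_sigma_leq]
    reduces to the linear one for even [m]. *)
Lemma s_c_plus_leq y m : ~~ odd m -> (s_c_plus y <= m)%N = (s_plus y <= m)%N.
Proof.
move=> om; apply/bigmax_leqP/s_plus_leP => [le_m e sz_e | le_m i _].
  (* The turn starting at index 0 suffices: a filling of [y] is extended by repeating its first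
     bit. *)
  case: y e sz_e le_m => [|a y] [|b e] //; first by rewrite sigma_nil.
  move=> sz_e /(_ ord0 isT) /bigmax_leqP; set y' := around _ _ => le_m.
  have y'E : y' = rcons (a :: y) a by rewrite /y' aroundE // rot0.
  have sz_e' : size (rcons (b :: e) b) == size y' by rewrite y'E !size_rcons sz_e.
  have := le_m (Tuple sz_e'); rewrite fill_zerosE -[tval _]/(rcons (b :: e) b) y'E fill_rcons //.
  rewrite -[if a == 0 then _ else _]/(head 0 (fill (a :: y) (b :: e))) last_rcons.
  move=> /(_ (eqxx _)); apply: leq_trans.
  by rewrite -/(cyclic_sigma _) cyclic_sigmaE ?fill_neq0 ?leq_addr.
apply/bigmax_leqP => e; rewrite fill_zerosE.
have := size_tuple e; move: (tval e) => {}e; rewrite aroundE // => sz_e /eqP hl.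
case/lastP: e sz_e hl => [|e0 b]; first by rewrite size_rcons.
rewrite !size_rcons size_rot => -[sz_e] hl.
have sz_er : size (rot i y) = size e0 by rewrite size_rot.
rewrite fill_rcons // in hl *; move: hl; set c := (if _ then _ else _) => hl.
have -> : c = head 0 (fill (rot i y) e0).
  move: hl; rewrite last_rcons => <-.
  have : size (fill (rot i y) e0) = size y by rewrite size_fill // size_rot.
  by case: (fill _ _) => //= sz0; have := ltn_ord i; rewrite -[X in (_ < X)%N]sz0.
rewrite -/(cyclic_sigma _) -(rotrK i e0) fill_rot ?size_rotr //.
  rewrite cyclic_sigma_rot cyclic_sigma_leq ?fill_neq0 //.
  by apply: le_m; rewrite size_rotr.
exact: ltnW.
Qed.

(** * Sign blocks and alternating rows *)

Lemma s_minus_cat s t : (s_minus s <= s_minus (s ++ t))%N.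
Proof.
rewrite /s_minus filter_cat; case/lastP: [seq _ <- s | _] => [|s' a].
  by rewrite sigma_nil.
by rewrite cat_rcons sigma_cat leq_addr.
Qed.

Lemma s_minus_rcons s a : (s_minus (rcons s a) <= (s_minus s).+1)%N.
Proof.
rewrite /s_minus filter_rcons; case: ifP => // _.
case/lastP: [seq _ <- s | _] => [|s' b]; first by rewrite sigma1.
rewrite -(cats1 (rcons _ _)) cat_rcons sigma_cat sigma_cons sigma1 addn0 -addn1.
by rewrite leq_add2l leq_b1.
Qed.

Lemma s_minus_leq s m : (count (fun a => a != 0%R) s <= m.+1)%N -> (s_minus s <= m)%N.
Proof.
rewrite -size_filter => le_m; apply: leq_trans (sigma_size _) _.
by case: (size _) le_m.
Qed.

(* Numbers the consecutive blocks on which y has weakly constant sign. *)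
Definition block y k := s_minus (take k.+1 y).

Lemma block0 y : block y 0 = 0%N.
Proof.
apply/eqP; rewrite -leqn0; apply/s_minus_leq/(leq_trans (count_size _ _)).
by case: y => [|a y] //=; rewrite take0.
Qed.

Lemma blockS y k : (block y k.+1 <= (block y k).+1)%N.
Proof.
rewrite /block; have [lt_ky | le_yk] := ltnP k.+1 (size y).
  by rewrite [in leqLHS](take_nth 0) // s_minus_rcons.
by rewrite !take_oversize ?leqnSn // (leq_trans le_yk).
Qed.

Lemma leq_block y : {homo block y : j k / (j <= k)%N}.
Proof.
apply: homo_leq => [//|j k l|k]; first exact: leq_trans.
rewrite /block; have [lt_ky | le_yk] := ltnP k.+1 (size y).
  by rewrite [X in (_ <= s_minus X)%N](take_nth 0) // -cats1 s_minus_cat.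
by rewrite !take_oversize // (leq_trans le_yk).
Qed.

Lemma block_last y k : (size y <= k.+1)%N -> block y k = s_minus y.
Proof. by move=> le_yk; rewrite /block take_oversize. Qed.

Lemma odd_block y k : (k < size y)%N -> y`_k != 0 ->
  odd (block y k) = (head 0 [seq a <- y | a != 0] * y`_k < 0).
Proof.
move=> lt_ky yk0; rewrite /block /s_minus.
rewrite -[X in head 0 (filter _ X)](cat_take_drop k.+1 y) filter_cat.
have := filter_neq0 (take k.+1 y); rewrite (take_nth 0) // filter_rcons yk0.
case: [seq _ <- _ | _] => [|a s] /=.
  by rewrite sigma1 -expr2 ltNge sqr_ge0.
case/andP => a0 s0; rewrite odd_sigma ?last_rcons //.
Qed.

(** By [odd_block], the parity of a block number gives the sign relative to the first nonzero
    entry. *)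
Lemma block_sign y j k : (j < size y)%N -> (k < size y)%N ->
  y`_j != 0 -> y`_k != 0 ->
  (y`_j * y`_k < 0) = odd (block y j) (+) odd (block y k).
Proof.
move=> lt_jy lt_ky yj0 yk0; rewrite !odd_block // !mulr_lt0 yj0 yk0 /=.
have -> /= : head 0 [seq a <- y | a != 0] != 0.
  have := filter_neq0 y; case E: [seq a <- y | a != 0] => [|a s] /=.
    by have : y`_j \in [::] by rewrite -E mem_filter yj0 mem_nth.
  by case/andP.
by case: (_ < 0); case: (_ < 0); case: (_ < 0).
Qed.

Lemma nat_ivt (b : nat -> nat) m l : b 0 = 0%N ->
  (forall k, b k.+1 <= (b k).+1)%N -> (l <= b m)%N ->
  exists2 k, (k <= m)%N & b k = l.
Proof.
move=> b0 bS; elim: m => [|m IHm].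
  by rewrite b0 leqn0 => /eqP ->; exists 0.
have [le_l _ | lt_l le_l] := leqP l (b m).
  by have [k le_km <-] := IHm le_l; exists k => //; apply: leqW.
by exists m.+1 => //; apply/eqP; rewrite eqn_leq le_l (leq_trans (bS m)).
Qed.

Lemma size_entries n (y : 'cV[R]_n) : size (entries y) = n.
Proof. by rewrite size_map size_enum_ord. Qed.

Lemma nth_entries n (y : 'cV[R]_n) (i : 'I_n) : (entries y)`_i = y i 0.
Proof. by rewrite (nth_map i) ?size_enum_ord // nth_ord_enum; congr (y _ _); apply: val_inj. Qed.

Lemma s_plus_alternating n (y : 'cV[R]_n) r : (0 < n)%N ->
  (r <= s_plus (entries y))%N ->
  exists (h : 'I_r.+1 -> 'I_n) (b : nat), increasing_sel h /\
    forall l : 'I_r.+1, 0 <= (-1) ^+ (b + l) * y (h l) 0.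
Proof.
move=> n_gt0 le_r.
have [e sz_e] : exists2 e : seq bool, size e = n & (r <= sigma (fill (entries y) e))%N.
  have [|e0 eE] := @bigop.eq_bigmax _ (fun e : (size (entries y)).-tuple bool => sigma (fill_zeros e)).
    by rewrite card_tuple expn_gt0 card_bool.
  exists (tval e0); first by rewrite size_tuple size_entries.
  by rewrite -fill_zerosE -eE.
set z := fill _ _ => le_rz.
have sz_z : size z = n by rewrite size_fill ?size_entries.
have sz : s_minus z = sigma z by rewrite /s_minus (all_filterP (fill_neq0 _ _)).
have zn0 k : (k < n)%N -> z`_k != 0.
  by move=> lt_kn; apply: (all_nthP 0 (fill_neq0 _ _)); rewrite sz_z.
(* The block numbers of the optimal filling [z] start at 0, grow by steps of at most one and reach
   [sigma z >= r], so each [l <= r] is attained. *)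
have /fin_all_exists [h hE] : forall l : 'I_r.+1, exists i : 'I_n, block z i = l.
  move=> l; have [|k le_k kl] := @nat_ivt (block z) n.-1 l (block0 z) (blockS z).
    by rewrite block_last ?sz ?sz_z ?leqSpred // (leq_trans _ le_rz) // -ltnS.
  have lt_kn : (k < n)%N by rewrite -(prednK n_gt0) ltnS.
  by exists (Ordinal lt_kn).
exists h, (z`_0 < 0)%R; split.
  move=> l l' lt_l; rewrite ltnNge; apply: contraL lt_l => le_h.
  by rewrite -leqNgt -!hE leq_block.
move=> l; have := block_sign (y := z) (j := 0) (k := h l).
rewrite sz_z => /(_ n_gt0 (ltn_ord _) (zn0 _ n_gt0) (zn0 _ (ltn_ord _))).
rewrite block0 hE /=.
have [-> _ | yn0] := eqVneq (y (h l) 0) 0; first by rewrite mulr0.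
have -> : z`_(h l) = y (h l) 0.
  rewrite (nth_map (0, false)) ?size_zip ?sz_e ?size_entries ?minnn //.
  by rewrite nth_zip ?sz_e ?size_entries //= nth_entries (negPf yn0).
have z0 := zn0 _ n_gt0; rewrite mulr_lt0 z0 yn0 /= -signr_odd oddD oddb.
case: (_ < 0) => /=; case: ltrP => ylt <-; rewrite ?mul1r ?mulN1r ?oppr_ge0 //; exact: ltW.
Qed.

Lemma leq_s_plus_alternating n (y : 'cV[R]_n) r (h : 'I_r.+1 -> 'I_n) (b : nat) :
  increasing_sel h -> (forall l : 'I_r.+1, 0 <= (-1) ^+ (b + l) * y (h l) 0) ->
  (r <= s_plus (entries y))%N.
Proof.
move=> h_inc h_alt.
have h_inj := increasing_sel_inj h_inc.
(* A zero at a selected row [h l] gets the sign that the alternation prescribes there; every other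
   zero becomes [1]. Block numbers of the filling then increase strictly along [h]. *)
pose e := mkseq (fun k => [exists l : 'I_r.+1, (h l == k :> nat) && odd (b + l)]) n.
have sz_e : size e = n by rewrite size_mkseq.
set z := fill (entries y) e.
have sz_z : size z = n by rewrite size_fill ?size_entries.
have sz : s_minus z = sigma z by rewrite /s_minus (all_filterP (fill_neq0 _ _)).
have zn0 k : (k < n)%N -> z`_k != 0.
  by move=> lt_kn; apply: (all_nthP 0 (fill_neq0 _ _)); rewrite sz_z.
have z_sign l : (z`_(h l) < 0) = odd (b + l).
  rewrite (nth_map (0, false)) ?size_zip ?sz_e ?size_entries ?minnn //.
  rewrite nth_zip ?sz_e ?size_entries //= nth_entries nth_mkseq //.
  have -> : [exists l' : 'I_r.+1, (h l' == h l :> nat) && odd (b + l')] = odd (b + l).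
    apply/existsP/idP => [[l' /andP[/eqP /val_inj /h_inj -> //]] | obl].
    by exists l; rewrite eqxx.
  have := h_alt l; rewrite -signr_odd; case: eqVneq => [_ _ | yn0].
    by case: (odd _); rewrite ?expr1 ?oppr_lt0 ?ltr01 // expr0 ltr10.
  case: (odd _); rewrite ?mul1r ?mulN1r ?oppr_ge0; first by rewrite lt_neqAle yn0 => ->.
  by move/le_gtF.
have le_block l (lt_l : (l < r.+1)%N) : (l <= block z (h (Ordinal lt_l)))%N.
  elim: l lt_l => // l IHl lt_l; set l1 := Ordinal lt_l; set l0 := Ordinal (ltnW lt_l).
  have lt_h : (h l0 < h l1)%N by apply: h_inc => /=.
  apply: leq_ltn_trans (IHl (ltnW lt_l)) _; rewrite -/l0 ltn_neqAle leq_block 1?ltnW //.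
  rewrite andbT; apply/eqP => eq_block.
  have := block_sign (y := z) (j := h l0) (k := h l1).
  rewrite sz_z => /(_ (ltn_ord _) (ltn_ord _) (zn0 _ (ltn_ord _)) (zn0 _ (ltn_ord _))).
  rewrite eq_block addbb mulr_lt0 !zn0 //= !z_sign /= addnS /=.
  by case: (odd _).
apply: leq_trans (_ : sigma z <= _)%N; last first.
  by apply: (s_plus_leP _ _ (leqnn _)); rewrite sz_e size_entries.
rewrite -sz; apply: leq_trans (le_block r (ltnSn r)) _.
by rewrite -{2}(cat_take_drop (h (Ordinal (ltnSn r))).+1 z) s_minus_cat.
Qed.



End SignVariations.

(** * Determinantal identities *)

Section Minors.
Variable R : comNzRingType.

(** Cramer's rule: each coordinate of the product is the Laplace expansion of a determinant with a
    repeated row, the matrix [M] of the proof. *)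
Lemma minor_col'_ker r (V : 'M[R]_(r, r.+1)) :
  V *m \col_l ((-1) ^+ l * \det (col' l V)) = 0.
Proof.
apply/colP => i; rewrite !mxE.
pose M := \matrix_(k, l) oapp (V ^~ l) (V i l) (unlift ord0 k).
have M0 l : M 0 l = V i l by rewrite mxE unlift_none.
have ML k l : M (lift 0 k) l = V k l by rewrite mxE liftK.
apply: etrans (_ : \det M = 0); last first.
  by apply: (@determinant_alternate _ _ M 0 (lift 0 i)) => // l; rewrite M0 ML.
rewrite (expand_det_row M 0); apply: eq_bigr => l _; rewrite mxE M0 /cofactor add0n.
congr (_ * (_ * \det _)); apply/matrixP => k j; rewrite !mxE; symmetry; by rewrite liftK.
Qed.

(** This sum is the expansion, along its first column, of the determinant of [[V c, V]], whose
    columns are dependent. *)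
Lemma sum_minor_row' r (V : 'M[R]_(r.+1, r)) (c : 'cV_r) :
  \sum_l (V *m c) l 0 * ((-1) ^+ l * \det (row' l V)) = 0.
Proof.
have /(congr1 (mulmx c^T)) := minor_col'_ker V^T; rewrite mulmx0 mulmxA -trmx_mul.
move=> /matrixP/(_ 0 0); rewrite !mxE => eq0; rewrite -[RHS]eq0.
by apply: eq_bigr => l _; rewrite [(_ ^T)%R 0 l]mxE [(\col_k _) l 0]mxE -tr_row' det_tr.
Qed.

(** Multilinearity in the columns of [P W]: a Cauchy-Binet formula before grouping by column sets.
    The sum runs over all maps, since the support of the [W] used later already singles out the
    increasing ones. *)
Lemma det_mulmx_expand r n (P : 'M[R]_(r, n)) (W : 'M_(n, r)) :
  \det (P *m W) =
    \sum_(phi : {ffun 'I_r -> 'I_n}) (\prod_b W (phi b) b) * \det (colsub phi P).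
Proof.
rewrite -det_tr /determinant.
under [RHS]eq_bigr => phi _ do rewrite -/(determinant _) -det_tr /determinant mulr_sumr.
rewrite exchange_big /=; apply: eq_bigr => s _.
under eq_bigr => i _ do rewrite !mxE.
rewrite bigA_distr_bigA mulr_sumr /=; apply: eq_bigr => phi _.
rewrite mulrCA -big_split /=; congr (_ * _); apply: eq_bigr => i _.
by rewrite !mxE mulrC.
Qed.

End Minors.

(** * Variation bounds from one-signed minors, and factorization along sign blocks *)

Section LinearVariation.
Variable R : realFieldType.

Lemma s_plus_mulmx_lt n r (U : 'M[R]_(n, r)) (e : R) (c : 'cV_r) : (0 < n)%N ->
  (forall f : 'I_r -> 'I_n, increasing_sel f -> 0 < e * \det (rowsub f U)) ->
  c != 0 -> (s_plus (entries (U *m c)) < r)%N.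
Proof.
move=> n_gt0 U_pos c0; rewrite ltnNge; apply: contraNN c0 => le_r.
have [h [b [h_inc y_alt]]] := s_plus_alternating n_gt0 le_r.
set y := U *m c in y_alt.
have h'_inc l : increasing_sel (h \o lift l) by apply: increasing_sel_lift.
have Vc l : (rowsub h U *m c) l 0 = y (h l) 0 by rewrite mul_rowsub_mx mxE.
have rowV l : row' l (rowsub h U) = rowsub (h \o lift l) U by apply/matrixP => i j; rewrite !mxE.
(* The terms t l of the expansion of det [y, U] are nonnegative. *)
pose t (l : 'I_r.+1) := (-1) ^+ (b + l) * y (h l) 0 * (e * \det (rowsub (h \o lift l) U)).
have t_ge0 l : true -> 0 <= t l.
  by move=> _; apply: mulr_ge0 => //; apply/ltW/U_pos/h'_inc.
have t_sum : \sum_l t l = 0.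
  have /(congr1 ( *%R ((-1) ^+ b * e))) := sum_minor_row' (rowsub h U) c.
  rewrite mulr0 mulr_sumr => sum0; apply: etrans sum0.
  by apply: eq_bigr => l _; rewrite Vc rowV /t exprD; ring.
have y0 l : y (h l) 0 = 0.
  have /eqP : t l = 0 by apply: (psumr_eq0P t_ge0 t_sum).
  rewrite /t mulf_eq0 (gt_eqF (U_pos _ (h'_inc l))) orbF mulf_eq0 signr_eq0.
  by move/eqP.
(* Any [r] of the selected rows of [U] form an invertible system, so the vanishing of [y] on them
   forces [c = 0]. *)
have : rowsub (h \o lift ord0) U *m c = 0.
  by apply/colP => i; rewrite mul_rowsub_mx mxE [RHS]mxE; apply: y0.
have U0 : rowsub (h \o lift ord0) U \in unitmx.
  rewrite unitmxE unitfE; apply/negP => /eqP d0.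
  by have := U_pos _ (h'_inc ord0); rewrite d0 mulr0 ltxx.
by move/(congr1 (mulmx (invmx (rowsub (h \o lift ord0) U)))); rewrite mulKmx // mulmx0 => ->.
Qed.

(** Column [b] of [W] carries weights on the [b]-th block of consecutive indices, and [c] holds the
    block sums of [x]. As the blocks are ordered, choosing one support index per column gives an
    increasing selection. *)
Lemma block_factorization n r (x : 'cV[R]_n) : (0 < r <= n)%N ->
  (s_minus (entries x) < r)%N ->
  exists (W : 'M[R]_(n, r)) (c : 'cV_r), [/\ x = W *m c,
    forall j b, 0 <= W j b, forall b, exists j, W j b != 0 &
    forall phi : 'I_r -> 'I_n, (forall b, W (phi b) b != 0) -> increasing_sel phi].
Proof.
case/andP=> r_gt0 le_rn lt_r; set y := entries x in lt_r *.
(* The second argument of the maximum refines the blocks of x into exactly r. *)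
pose beta k := maxn (block y k) (k - (n - r)).
have beta0 : beta 0 = 0%N by rewrite /beta block0.
have betaS k : (beta k.+1 <= (beta k).+1)%N by have := blockS y k; rewrite /beta; lia.
have leq_beta : {homo beta : j k / (j <= k)%N}.
  by move=> j k le_jk; have := leq_block y le_jk; rewrite /beta; lia.
have beta_lt (j : 'I_n) : (beta j < r)%N.
  have : (block y j <= s_minus y)%N.
    by rewrite -[in leqRHS](cat_take_drop j.+1 y) s_minus_cat.
  by have := ltn_ord j; rewrite /beta; lia.
(* Once positive, the term [k - (n - r)] grows strictly, so a repeated value of [beta] must come
   from a constant block number. *)
have beta_block j k : (j <= k)%N -> beta j = beta k -> block y j = block y k.
  rewrite leq_eqVlt => /predU1P[-> // | lt_jk].
  by have := leq_block y (ltnW lt_jk); rewrite /beta; lia.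
have same_sign (j k : 'I_n) : beta j = beta k -> 0 <= x j 0 * x k 0.
  move=> eq_b; have eq_block : block y j = block y k.
    by have [/beta_block -> // | /ltnW /beta_block ->] := leqP j k.
  have [-> | xj0] := eqVneq (x j 0) 0; first by rewrite mul0r.
  have [-> | xk0] := eqVneq (x k 0) 0; first by rewrite mulr0.
  have := @block_sign _ y j k; rewrite !size_entries !nth_entries => /(_ _ _ xj0 xk0).
  by rewrite eq_block addbb leNgt => ->.
pose c b := \sum_(j : 'I_n | beta j == b) x j 0.
(* If a block sum vanishes, so does [x] on that block, its entries having weakly one sign; weight 1
   then keeps the column of [W] nonzero. *)
pose w (j : 'I_n) := if c (beta j) == 0 then 1 else x j 0 / c (beta j).
have xc_ge (j : 'I_n) : 0 <= x j 0 ^+ 2 <= x j 0 * c (beta j).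
  rewrite sqr_ge0 /= /c mulr_sumr (bigD1 j) //= -expr2 lerDl sumr_ge0 // => k /andP[/eqP eq_b _].
  exact: same_sign.
have xE j : x j 0 = w j * c (beta j).
  rewrite /w; case: eqVneq => [c0 | c0]; last by rewrite divfK.
  have := xc_ge j; rewrite c0 !mulr0 => /le_anti /esym/eqP.
  by rewrite sqrf_eq0 => /eqP.
have w_ge0 j : 0 <= w j.
  rewrite /w; case: eqVneq => // c0; have /andP[/le_trans le_t /le_t] := xc_ge j.
  have -> : x j 0 / c (beta j) = x j 0 * c (beta j) * (c (beta j))^-1 ^+ 2 by field.
  by move=> xc; rewrite mulr_ge0 ?sqr_ge0.
exists (\matrix_(j, b) (if beta j == b then w j else 0)), (\col_b c b); split.
- apply/colP => j; rewrite mxE (bigD1 (Ordinal (beta_lt j))) //= !mxE eqxx -xE.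
  rewrite big1 ?addr0 // => b b_neq; rewrite !mxE; case: eqP => [eq_b | _]; last exact: mul0r.
  by case/negP: b_neq; apply/eqP/val_inj.
- by move=> j b; rewrite mxE; case: ifP.
- move=> b; have [c0 | c0] := eqVneq (c b) 0.
    have [|k le_k kb] := @nat_ivt beta n.-1 b beta0 betaS.
      by have := ltn_ord b; rewrite /beta; lia.
    have lt_kn : (k < n)%N by lia.
    by exists (Ordinal lt_kn); rewrite mxE /= kb eqxx /w kb c0 eqxx oner_eq0.
  have : ~~ [forall (j : 'I_n | beta j == b), x j 0 == 0].
    apply: contraNN c0 => /forall_inP x0; apply/eqP/big1 => j /x0 /eqP //.
  rewrite negb_forall => /existsP[j]; rewrite negb_imply => /andP[/eqP bj xj0].
  by exists j; rewrite mxE bj eqxx /w bj (negPf c0) mulf_neq0 ?invr_eq0.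
move=> phi phi_b b b' lt_b.
have beta_phi a : beta (phi a) = a.
  by have := phi_b a; rewrite mxE; case: (beta _ =P _) => // _; rewrite eqxx.
rewrite ltnNge; apply: contraL lt_b => /leq_beta.
by rewrite !beta_phi leqNgt.
Qed.

End LinearVariation.

(** * Sign regularity and linear variation diminution at a fixed order *)

Section SignRegularity.
Variable R : realFieldType.

Lemma SSR_s_plus_lt n r (A : 'M[R]_n) (x : 'cV_n) : (0 < r <= n)%N ->
  SSR r A -> x != 0 -> (s_minus (entries x) < r)%N ->
  (s_plus (entries (A *m x)) < r)%N.
Proof.
move=> r_bound [minor_neq0 minor_sg] x0 lt_r; have /andP[r_gt0 le_rn] := r_bound.
have [W [c [xE W_ge0 W_neq0 W_inc]]] := block_factorization r_bound lt_r.
pose f0 := widen_ord le_rn.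
have f0_inc : increasing_sel f0 by [].
set e := Num.sg (\det (mxsub f0 f0 A)).
have minor_gt0 (f g : 'I_r -> 'I_n) : increasing_sel f -> increasing_sel g -> 0 < e * \det (mxsub f g A).
  move=> f_inc g_inc; rewrite /e -(minor_sg f f0 g f0) // -normrEsg normr_gt0.
  exact: minor_neq0.
rewrite xE mulmxA; apply: (@s_plus_mulmx_lt _ _ _ _ e); first exact: leq_trans r_gt0 le_rn.
  move=> f f_inc; rewrite -mul_rowsub_mx det_mulmx_expand mulr_sumr.
  have det_sub (phi : {ffun 'I_r -> 'I_n}) : colsub phi (rowsub f A) = mxsub f phi A.
    by apply/matrixP => i j; rewrite !mxE.
  have [psi psiP] := fin_all_exists W_neq0.
  have psi_neq0 : \prod_b W ([ffun b => psi b] b) b != 0.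
    by apply/prodf_neq0 => b _; rewrite ffunE.
  (* All terms are nonnegative, and the one of [psi], which picks a nonzero weight in every column,
     is strictly positive. *)
  rewrite (bigD1 [ffun b => psi b]) //=; apply: ltr_pwDl.
    rewrite mulrCA det_sub mulr_gt0 //.
      by rewrite lt_neqAle eq_sym psi_neq0 prodr_ge0.
    by apply: minor_gt0 => //; apply: W_inc => b; rewrite ffunE.
  apply: sumr_ge0 => phi _; rewrite mulrCA det_sub.
  have [-> | phi_neq0] := eqVneq (\prod_b W (phi b) b) 0; first by rewrite mul0r.
  rewrite mulr_ge0 ?prodr_ge0 //; apply/ltW/minor_gt0 => //; apply: W_inc => b.
  by move/prodf_neq0: phi_neq0; apply.
by apply: contraNneq x0 => c0; rewrite xE c0 mulmx0.
Qed.

(** Multiplying a vector by it on the left spreads the coordinates over the positions [g] and pads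
    with zeros; multiplying [A] by it on the right extracts columns. *)
Definition sel_mx r n (g : 'I_r -> 'I_n) : 'M[R]_(n, r) :=
  \matrix_(j, b) (j == g b)%:R.

Lemma mul_sel_mx m n r (g : 'I_r -> 'I_n) (A : 'M_(m, n)) : A *m sel_mx g = colsub g A.
Proof.
apply/matrixP => i b; rewrite !mxE (bigD1 (g b)) //= mxE eqxx mulr1 big1 ?addr0 // => j.
by rewrite mxE => /negPf ->; rewrite mulr0.
Qed.

Lemma sel_mx_in n r (g : 'I_r -> 'I_n) (c : 'cV_r) b : injective g ->
  (sel_mx g *m c) (g b) 0 = c b 0.
Proof.
move=> g_inj; rewrite mxE (bigD1 b) //= mxE eqxx mul1r big1 ?addr0 // => b'.
by rewrite mxE inj_eq // eq_sym => /negPf ->; rewrite mul0r.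
Qed.

Lemma sel_mx_out n r (g : 'I_r -> 'I_n) (c : 'cV_r) j : j \notin codom g ->
  (sel_mx g *m c) j 0 = 0.
Proof.
move=> gj; rewrite mxE big1 // => b _; rewrite mxE.
by case: eqP gj => [-> | _ _]; rewrite ?codom_f ?mul0r.
Qed.

Lemma sel_mx_neq0 n r (g : 'I_r -> 'I_n) (c : 'cV_r) : injective g ->
  c != 0 -> sel_mx g *m c != 0.
Proof.
move=> g_inj; apply: contraNneq => x0; apply/eqP/colP => b.
by rewrite -(sel_mx_in c b g_inj) x0 !mxE.
Qed.

Lemma filter_entries n (x : 'cV[R]_n) :
  [seq a <- entries x | a != 0] = [seq x i 0 | i <- enum 'I_n & x i 0 != 0].
Proof. by rewrite filter_map. Qed.

Lemma s_minus_sel_mx_lt n r (g : 'I_r -> 'I_n) (c : 'cV_r) : (0 < r)%N ->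
  (s_minus (entries (sel_mx g *m c)) < r)%N.
Proof.
case: r g c => // r g c _; rewrite ltnS; apply: s_minus_leq.
rewrite -size_filter filter_entries size_map.
apply: (@leq_trans (size (codom g))); last by rewrite size_codom card_ord.
apply: uniq_leq_size => [|i]; first by rewrite filter_uniq ?enum_uniq.
rewrite mem_filter => /andP[xi0 _]; apply: contraR xi0 => /sel_mx_out ->.
by rewrite eqxx.
Qed.

Lemma entries_sel_mx n r (g : 'I_r -> 'I_n) (c : 'cV_r) : increasing_sel g ->
  (forall b, c b 0 != 0) ->
  [seq a <- entries (sel_mx g *m c) | a != 0] = entries c.
Proof.
move=> g_inc c0; have g_inj := increasing_sel_inj g_inc; rewrite filter_entries.
have -> : [seq i <- enum 'I_n | (sel_mx g *m c) i 0 != 0] = [seq g b | b <- enum 'I_r].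
  apply: (@irr_sorted_eq _ (relpre (@nat_of_ord n) ltn)).
  - by move=> ? ? ?; apply: ltn_trans.
  - by move=> ?; apply: ltnn.
  - apply: sorted_filter => [? ? ?|]; first exact: ltn_trans.
    by have := iota_ltn_sorted 0 n; rewrite -val_enum_ord sorted_map.
  - rewrite sorted_map; have := iota_ltn_sorted 0 r; rewrite -val_enum_ord sorted_map.
    by apply: sub_sorted => b b' /g_inc.
  move=> i; rewrite mem_filter mem_enum andbT.
  apply/idP/mapP => [|[b _ ->]]; last by rewrite sel_mx_in.
  move=> xi0; have /codomP[b ib] : i \in codom g.
    by apply: contraR xi0 => /sel_mx_out ->; rewrite eqxx.
  by exists b; rewrite ?mem_enum.
by rewrite -map_comp; apply: eq_map => b /=; rewrite sel_mx_in.
Qed.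

(** The [r] zeros together with one further row alternate weakly, because the zeros may take
    whatever signs the extra row dictates. *)
Lemma leq_s_plus_zeros n r (f : 'I_r -> 'I_n) (y : 'cV[R]_n) : (r < n)%N ->
  injective f -> (forall b, y (f b) 0 = 0) -> (r <= s_plus (entries y))%N.
Proof.
move=> lt_rn f_inj y0.
have card_im : #|f @: 'I_r| = r by rewrite card_imset ?card_ord.
have [i i_im] : exists i, i \in ~: (f @: 'I_r).
  by apply/set0Pn; rewrite -card_gt0; have := cardsC (f @: 'I_r); rewrite card_im card_ord; lia.
have card_S : #|i |: f @: 'I_r| = r.+1 by rewrite cardsU1 -in_setC i_im card_im.
have [h h_inc h_in] := increasing_sel_set card_S.
have yh l : h l != i -> y (h l) 0 = 0.
  by move=> hl; have := h_in l; rewrite !inE (negPf hl) /= => /imsetP[b _ ->].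
have [l0 hl0 | no_i] := pickP (fun l => h l == i).
  (* The offset makes the sign prescribed at position [l0] that of [y i], since [l0] is then counted
     twice. *)
  apply: (@leq_s_plus_alternating _ _ _ _ h ((y i 0 < 0)%R + l0)) => // l.
  have [hl | /yh ->] := eqVneq (h l) i; last by rewrite mulr0.
  have -> : l = l0 by apply: (increasing_sel_inj h_inc); rewrite hl (eqP hl0).
  rewrite (eqP hl0) -signr_odd -addnA oddD oddb addnn odd_double addbF.
  by case: ltrP => [/ltW|] yi; rewrite ?mul1r ?mulN1r ?oppr_ge0.
by apply: (@leq_s_plus_alternating _ _ _ _ h 0) => // l; rewrite yh ?mulr0 ?no_i.
Qed.

Lemma sg_neq_lt0 (a b : R) : a != 0 -> b != 0 -> Num.sg a != Num.sg b -> a * b < 0.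
Proof.
move=> a0 b0; rewrite mulr_lt0 a0 b0 /= -(sgr_lt0 a) -(sgr_lt0 b).
by case: (sgrP a) a0; case: (sgrP b) b0; rewrite ?eqxx ?ltrN10 ?ltr10.
Qed.

(** * From linear variation diminution back to the minors *)

Section Converse.
Variables (n r : nat) (A : 'M[R]_n).
Hypotheses (r_gt0 : (0 < r)%N)
  (A_vd : forall x : 'cV_n, x != 0 -> (s_minus (entries x) < r)%N ->
     (s_plus (entries (A *m x)) < r)%N).

(** A kernel vector of a singular minor, padded with zeros, has at most [r] nonzero entries, yet its
    image vanishes on the [r] rows [f]. *)
Lemma vd_minor_neq0 (f g : 'I_r -> 'I_n) : (r < n)%N -> injective f -> injective g ->
  \det (mxsub f g A) != 0.
Proof.
move=> lt_rn f_inj g_inj; rewrite -det_tr; apply/negP => /det0P[v v0 vM].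
have c0 : v^T != 0 by rewrite trmx_eq0.
have := A_vd (sel_mx_neq0 g_inj c0) (s_minus_sel_mx_lt _ _ r_gt0).
rewrite ltnNge (leq_s_plus_zeros lt_rn f_inj) // => b.
rewrite mulmxA mul_sel_mx.
have /(congr1 trmx)/colP/(_ b) := vM.
by rewrite trmx_mul trmxK mxE !mxE => vMb; rewrite -[RHS]vMb; apply: eq_bigr => k _; rewrite !mxE.
Qed.

Lemma increasing_sel_ltn m (h : 'I_r.+1 -> 'I_m) : increasing_sel h -> (r < m)%N.
Proof. by move/increasing_sel_inj/leq_card; rewrite !card_ord. Qed.

(** If two such minors had opposite signs, some vector supported on the [r] columns [g] would have
    an image that alternates weakly along all [r + 1] rows of [h]. *)
Lemma vd_sg_row (h : 'I_r.+1 -> 'I_n) (g : 'I_r -> 'I_n) i j :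
  increasing_sel h -> increasing_sel g ->
  Num.sg (\det (mxsub (h \o lift i) g A)) = Num.sg (\det (mxsub (h \o lift j) g A)).
Proof.
move=> h_inc g_inc; have lt_rn := increasing_sel_ltn h_inc.
have g_inj := increasing_sel_inj g_inc.
have h'_inj l := increasing_sel_inj (increasing_sel_lift l h_inc).
pose V := mxsub h g A; pose d l := \det (row' l V).
have dE l : \det (mxsub (h \o lift l) g A) = d l.
  by congr (\det _); apply/matrixP => a b; rewrite !mxE.
have d0 l : d l != 0 by rewrite -dE vd_minor_neq0.
rewrite !dE; apply/eqP/negP => /negP sg_neq.
have dij := sg_neq_lt0 (d0 i) (d0 j) sg_neq.
have [k ik | ij] := unliftP j i; last by rewrite ij eqxx in sg_neq.
(* V c vanishes off i and j; its entries there alternate iff d i * d j < 0. *)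
pose c := invmx (row' j V) *m \col_a (if a == k then (-1) ^+ i else 0).
have Vc a : (V *m c) (lift j a) 0 = if a == k then (-1) ^+ i else 0.
  have /colP/(_ a) : row' j V *m c = \col_a (if a == k then (-1) ^+ i else 0).
    by rewrite mulKVmx // unitmxE unitfE; apply: (d0 j).
  by rewrite [RHS]mxE => <-; rewrite !mxE; apply: eq_bigr => b _; rewrite !mxE.
have Vci : (V *m c) i 0 = (-1) ^+ i by rewrite ik Vc eqxx -ik.
(* In the identity [sum_minor_row'] only the terms of [i] and [j] survive, which determines the
   entry at [j]. *)
have Vcj : (-1) ^+ j * (V *m c) j 0 = - (d i / d j).
  have := sum_minor_row' V c; rewrite (bigD1 j) //= (bigD1 i) /=; last by rewrite ik eq_sym neq_lift.
  rewrite big1 => [|l /andP[]]; last first.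
    case: (unliftP j l) => [a -> _ | ->]; last by rewrite eqxx.
    by rewrite ik (inj_eq lift_inj) Vc => /negPf ->; rewrite mul0r.
  rewrite Vci addr0 signrMK -/(d i) -/(d j) => eq0.
  apply: (mulIf (d0 j)); rewrite mulNr divfK //; apply/eqP; rewrite -addr_eq0 -eq0.
  by apply/eqP; ring.
have c0 : c != 0.
  by apply/eqP => c0; have/eqP := Vci; rewrite c0 mulmx0 mxE eq_sym signr_eq0.
have := A_vd (sel_mx_neq0 g_inj c0) (s_minus_sel_mx_lt _ _ r_gt0).
rewrite ltnNge (@leq_s_plus_alternating _ _ _ _ h 0) // => l.
have -> : (A *m (sel_mx g *m c)) (h l) 0 = (V *m c) l 0.
  by rewrite mulmxA mul_sel_mx !mxE; apply: eq_bigr => b _; rewrite !mxE.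
rewrite add0n; case: (unliftP j l) => [a -> | ->].
  rewrite Vc; case: eqP => [-> | _]; last by rewrite mulr0.
  by rewrite -ik -expr2 sqr_ge0.
by rewrite Vcj oppr_ge0 ltW //; move: dij; rewrite !mulr_lt0 invr_eq0 invr_lt0.
Qed.

(** The vector of signed minors is sent to zero on the [r] rows [f], so the hypothesis forces it to
    have at least [r] variations. Its [r + 1] entries then alternate strictly, and the factors
    [(-1) ^+ l] leave minors of one sign. *)
Lemma vd_sg_col (f : 'I_r -> 'I_n) (h : 'I_r.+1 -> 'I_n) i j :
  increasing_sel f -> increasing_sel h ->
  Num.sg (\det (mxsub f (h \o lift i) A)) = Num.sg (\det (mxsub f (h \o lift j) A)).
Proof.
move=> f_inc h_inc; have lt_rn := increasing_sel_ltn h_inc.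
have f_inj := increasing_sel_inj f_inc; have h_inj := increasing_sel_inj h_inc.
have h'_inj l := increasing_sel_inj (increasing_sel_lift l h_inc).
pose V := mxsub f h A; pose d l := \det (col' l V).
have dE l : \det (mxsub f (h \o lift l) A) = d l.
  by congr (\det _); apply/matrixP => a b; rewrite !mxE.
have d0 l : d l != 0 by rewrite -dE vd_minor_neq0.
pose c : 'cV_r.+1 := \col_l ((-1) ^+ l * d l).
have cl0 l : c l 0 != 0 by rewrite mxE mulf_neq0 ?signr_eq0.
have c0 : c != 0 by apply: contraNneq (cl0 ord0) => ->; rewrite mxE.
have ge_r : (r <= s_minus (entries (sel_mx h *m c)))%N.
  rewrite leqNgt; apply/negP => /(A_vd (sel_mx_neq0 h_inj c0)).
  rewrite ltnNge (leq_s_plus_zeros lt_rn f_inj) // => b.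
  rewrite mulmxA mul_sel_mx; have /colP/(_ b) := minor_col'_ker V.
  by rewrite [RHS]mxE => eq0; rewrite -[RHS]eq0 !mxE; apply: eq_bigr => l _; rewrite !mxE.
have d_step (l l' : 'I_r.+1) : l' = l.+1 :> nat -> Num.sg (d l) = Num.sg (d l').
  move=> l'E; have lt_l : (l < (size (entries c)).-1)%N.
    by rewrite size_entries /= -ltnS -l'E.
  (* There are only [r] consecutive pairs, so [r] variations make every pair a sign change. *)
  have : Ordinal lt_l \in [set k : 'I_(size (entries c)).-1 |
                             (entries c)`_k * (entries c)`_k.+1 < 0].
    rewrite (_ : [set _ | _] = setT) ?inE //; apply/eqP.
    rewrite eqEcard subsetT cardsT card_ord [in leqLHS]size_entries.
    by move: ge_r; rewrite /s_minus entries_sel_mx.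
  rewrite inE /= -l'E !nth_entries !mxE l'E exprS => lt0.
  apply/eqP/negP => /negP /(sg_neq_lt0 (d0 l) (d0 l')); apply/negP; rewrite -leNgt ltW //.
  rewrite -oppr_lt0; apply: le_lt_trans lt0; rewrite le_eqVlt; apply/orP; left; apply/eqP.
  have := sqrr_sign R l; set s := (-1) ^+ l => ss.
  by transitivity (- (s ^+ 2 * (d l * d l'))); [rewrite ss mul1r | ring].
rewrite !dE; have d_const (l : 'I_r.+1) : Num.sg (d l) = Num.sg (d ord0).
  case: l => l lt_l; elim: l lt_l => [|l IHl] lt_l; first by congr (Num.sg (d _)); apply: val_inj.
  by rewrite -(IHl (ltnW lt_l)); symmetry; apply: d_step.
by rewrite !d_const.
Qed.

Lemma vd_SSR : (r <= n)%N -> A \in unitmx -> SSR r A.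
Proof.
move=> le_rn A_unit.
have sg_eq (f f' g g' : 'I_r -> 'I_n) : increasing_sel f -> increasing_sel f' ->
    increasing_sel g -> increasing_sel g' ->
    Num.sg (\det (mxsub f g A)) = Num.sg (\det (mxsub f' g' A)).
  move=> f_inc f'_inc g_inc g'_inc; transitivity (Num.sg (\det (mxsub f' g A))).
    apply: (increasing_sel_chain (phi := fun f => Num.sg (\det (mxsub f g A)))) => //.
      by move=> f1 f2 eq_f; congr (Num.sg (\det _)); apply/matrixP => a b; rewrite !mxE eq_f.
    by move=> h i j h_inc; apply: vd_sg_row.
  apply: (increasing_sel_chain (phi := fun g => Num.sg (\det (mxsub f' g A)))) => //.
    by move=> g1 g2 eq_g; congr (Num.sg (\det _)); apply/matrixP => a b; rewrite !mxE eq_g.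
  by move=> h i j h_inc; apply: vd_sg_col.
split=> // f g f_inc g_inc.
(* For [r = n] the minor equals the determinant of [A], nonzero by invertibility. *)
have [lt_rn | ge_rn] := ltnP r n.
  by apply: vd_minor_neq0 => //; apply: increasing_sel_inj.
have f0_inc : increasing_sel (widen_ord le_rn) by [].
rewrite -sgr_eq0 (sg_eq f (widen_ord le_rn) g (widen_ord le_rn)) // sgr_eq0.
have eq_rn : r = n by apply/eqP; rewrite eqn_leq le_rn.
case: n / eq_rn le_rn A A_unit {f0_inc sg_eq} => le_rr B B_unit.
rewrite (_ : mxsub _ _ B = B) -?unitfE -?unitmxE //.
by apply/matrixP => i j; rewrite mxE; congr (B _ _); apply: val_inj.
Qed.

End Converse.
End SignRegularity.

Theorem theorem2 (R : realType) (n : nat) (hn : (1 <= n)%N)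
    (A : 'M[R]_n) (hA : A \in unitmx) :
  (forall x : 'cV[R]_n, x != 0 ->
     (s_c_plus (entries (A *m x)) <= s_c_minus (entries x))%N)
  <->
  (forall r : nat, (1 <= r <= n)%N -> odd r -> SSR r A).
Proof.
split=> [A_vd r /andP[r_gt0 le_rn] r_odd | A_ssr x x0].
  apply: vd_SSR => // x x0; rewrite -(prednK r_gt0) !ltnS.
  have r_even : ~~ odd r.-1 by move: r_odd; rewrite -{1}(prednK r_gt0).
  rewrite -(s_c_minus_leq _ r_even) -(s_c_plus_leq _ r_even).
  exact: leq_trans (A_vd x x0).
(* As [m] is even, the order [m.+1] is odd and condition (2) applies to it when [m < n]; otherwise
   the bound holds because a vector of length [n] has at most [n.-1] variations. *)
set m := s_c_minus _; have m_even : ~~ odd m by apply: s_c_minus_even.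
rewrite s_c_plus_leq //; have [lt_mn | le_nm] := ltnP m n.
  have := SSR_s_plus_lt (r := m.+1) (A := A) (x := x).
  rewrite ltnS lt_mn => /(_ isT); apply => //; first by apply: A_ssr => //=.
  by rewrite ltnS -s_c_minus_leq.
apply/s_plus_leP => e sz_e; apply: leq_trans (sigma_size _) _.
by rewrite size_fill // size_entries (leq_trans (leq_pred _)).
Qed.
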